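(* Let $G=(V,E)$ be an undirected graph with edge costs $c:E\to\mathbb{R}_+$ and terminal set $W\subseteq V$, and let $T$ be a hub tree with edge capacities $b:E(T)\to\mathbb{R}_+$. Then among all hierarchical hubbings for $\mathcal{U}(T^b)$ into $G$, there is a minimum-cost one that is a $T$-hubbing; i.e., the optimal hierarchical hubbing for $\mathcal{U}(T^b)$ is a $T$-hubbing.
   Context: Demands are symmetric: a demand pattern is a vector $D\in\mathbb{R}_+^{\binom{W}{2}}$ indexed by unordered pairs of terminals. A hub tree is a tree whose leaf set is exactly $W$. For a hub tree $T'$ and $\{i,j\}\subseteq W$, let $T'_{ij}$ be the unique $i$-$j$ path in $T'$. $\mathcal{U}(T^b)$ is the set of all $D\in\mathbb{R}_+^{\binom{W}{2}}$ with $\sum_{\{i,j\}: f\in T_{ij}} D_{ij}\le b(f)$ for every $f\in E(T)$. For a hub tree $T'$, a $T'$-embedding into $G$ is a map $\phi$ assigning to each $v\in V(T')$ a vertex $\phi(v)\in V$, with $\phi(i)=i$ for all $i\in W$, and to each edge $vw\in E(T')$ a simple $\phi(v)$-$\phi(w)$ path $\phi(vw)$ in $G$. Given a convex universe $\mathcal{U}\subseteq\mathbb{R}_+^{\binom{W}{2}}$, a $T'$-hubbing for $\mathcal{U}$ into $G$ is a pair $(\phi,u)$ with $\phi$ a $T'$-embedding and $u:E\to\mathbb{R}_+$ satisfying $u(e)\ge\sum_{f\in E(T'):\, e\in\phi(f)}\beta(f)$ for all $e\in E$, where $\beta(f)=\max_{D\in\mathcal{U}}\sum_{\{i,j\}:\,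 f\in T'_{ij}} D_{ij}$. A hierarchical hubbing for $\mathcal{U}$ is a $T'$-hubbing for $\mathcal{U}$ for some hub tree $T'$. Its cost is $\sum_{e\in E}c(e)u(e)$. *)

(* Defs.v *)
From mathcomp Require Import all_boot all_order all_algebra.
From mathcomp Require Import boolp reals.
Set Implicit Arguments. Unset Strict Implicit. Unset Printing Implicit Defensive.
Import Order.TTheory GRing.Theory Num.Theory.
Local Open Scope ring_scope.

Section Graphs.
Variable T : finType.

Definition simple_edges (E : {set {set T}}) : Prop :=
  forall e, e \in E -> #|e| = 2%N.

Definition spath (E : {set {set T}}) (x y : T) (p : seq T) : bool :=
  match p with
  | [::] => false
  | a :: s => [&& a == x, last a s == y,
                 path (fun u v => [set u; v] \in E) a s & uniq (a :: s)]
  end.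

Definition on_path (p : seq T) (e : {set T}) : bool :=
  match p with
  | [::] => false
  | a :: s => has (fun ab => [set ab.1; ab.2] == e) (zip (a :: s) s)
  end.

Definition connected_graph (E : {set {set T}}) : Prop :=
  forall x y : T, exists p, spath E x y p.

Definition acyclic_graph (E : {set {set T}}) : Prop :=
  ~ exists (a : T) (s : seq T),
      [/\ (2 <= size s)%N, uniq (a :: s),
          path (fun u v => [set u; v] \in E) a s & [set last a s; a] \in E].

Definition is_tree (E : {set {set T}}) : Prop :=
  [/\ (0 < #|T|)%N, simple_edges E, connected_graph E & acyclic_graph E].

Definition degree (E : {set {set T}}) (v : T) : nat := #|[set f in E | v \in f]|.

End Graphs.

Section Hub.
Variables (R : realType) (V : finType) (W : {set V}).

Definition pairs : {set {set V}} := [set p : {set V} | (p \subset W) && (#|p| == 2)%N].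

(* A hub tree on the vertex type VT with edges ET; the terminal i \in W is the
   tree vertex iota i.  Its leaf set is exactly (the image of) W. *)
Definition hub_tree (VT : finType) (ET : {set {set VT}}) (iota : V -> VT) : Prop :=
  [/\ is_tree ET, {in W &, injective iota}
    & forall v : VT, (degree ET v == 1%N) = (v \in iota @: W)].

Definition tpath_edge (VT : finType) (ET : {set {set VT}}) (iota : V -> VT)
    (p : {set V}) (f : {set VT}) : Prop :=
  exists i j : V, p = [set i; j] /\
    exists q, spath ET (iota i) (iota j) q /\ on_path q f.

Definition load (VT : finType) (ET : {set {set VT}}) (iota : V -> VT)
    (D : {set V} -> R) (f : {set VT}) : R :=
  \sum_(p in pairs) (if `[< tpath_edge ET iota p f >] then D p else 0).

Definition UTb (VT : finType) (ET : {set {set VT}}) (iota : V -> VT)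
    (b : {set VT} -> R) (D : {set V} -> R) : Prop :=
  (forall p, p \in pairs -> 0 <= D p) /\
  (forall f, f \in ET -> load ET iota D f <= b f).

Definition is_beta (U : ({set V} -> R) -> Prop) (VT : finType) (ET : {set {set VT}})
    (iota : V -> VT) (beta : {set VT} -> R) : Prop :=
  forall f, f \in ET ->
    (exists D, U D /\ load ET iota D f = beta f) /\
    (forall D, U D -> load ET iota D f <= beta f).

Definition embedding (E : {set {set V}}) (VT : finType) (ET : {set {set VT}})
    (iota : V -> VT) (phiv : VT -> V) (phie : {set VT} -> seq V) : Prop :=
  (forall i, i \in W -> phiv (iota i) = i) /\
  (forall f, f \in ET -> exists v w : VT,
       f = [set v; w] /\ spath E (phiv v) (phiv w) (phie f)).

Definition hubbing (E : {set {set V}}) (U : ({set V} -> R) -> Prop)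
    (VT : finType) (ET : {set {set VT}}) (iota : V -> VT)
    (phiv : VT -> V) (phie : {set VT} -> seq V) (u : {set V} -> R) : Prop :=
  [/\ embedding E ET iota phiv phie,
      (forall e, e \in E -> 0 <= u e)
    & exists beta, is_beta U ET iota beta /\
        forall e, e \in E -> \sum_(f in ET | on_path (phie f) e) beta f <= u e].

Definition cost (E : {set {set V}}) (c u : {set V} -> R) : R :=
  \sum_(e in E) c e * u e.

End Hub.

(* Main.v *)
(* Let T' be any hub tree, rooted, and for f in E(T') let X_f be the set of
   terminals below f. By max-flow min-cut in T^b, the load beta'(f) equals the
   minimum capacity of a cut of T^b separating X_f from the other terminals. Let
   M_f be the inclusion-minimal such cut. By sub- and posimodularity the M_f are
   nested or disjoint exactly as the X_f are, so each vertex v of T has a vertex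
   psi(v) of T' lying below precisely those f with v in M_f. Sending an edge vw of T
   into the image of the T'-path from psi(v) to psi(w) gives a T-embedding, and
   each e in E carries at most the sum of b(vw) over all pairs of an edge vw of T
   and an f with e in phi'(f) and vw crossing M_f, that is, at most the sum of
   cap(M_f) = beta'(f) over these f. So the given u' is also feasible for a
   T-hubbing, and the optimum is attained because a T-embedding matters only
   through its edge sets.

   Max-flow min-cut is proved by induction on the number of positive slacks (of
   edges and of cuts): decrease the capacity of an edge lying in no minimum cut,
   or push flow along a path that crosses every minimum cut exactly once. *)
Require Import Defs.
From mathcomp Require Import all_boot all_order all_algebra.
From mathcomp Require Import boolp reals.
From mathcomp Require Import lra.
Import Order.TTheory GRing.Theory Num.Theory.
Local Open Scope ring_scope.

(** * Paths, cuts and rooted trees *)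

(** Stated for an arbitrary set [f], so that it serves tree edges and terminal pairs alike without
    ordering their two ends. *)
Definition crosses {T : finType} (f S : {set T}) : bool :=
  (f :&: S != set0) && ~~ (f \subset S).

Section GraphFacts.
Context {T : finType}.
Implicit Types (E : {set {set T}}) (f g S : {set T}) (p s : seq T).

Lemma crosses2 (u v : T) S : crosses [set u; v] S = (u \in S) (+) (v \in S).
Proof.
rewrite /crosses subUset !sub1set.
have -> : ([set u; v] :&: S != set0) = (u \in S) || (v \in S).
  apply/set0Pn/orP => [[x]|[uS|vS]].
  - by rewrite !inE => /andP[/orP[]/eqP-> ->]; [left|right].
  - by exists u; rewrite !inE eqxx uS.
  - by exists v; rewrite !inE eqxx orbT vS.
by case: (u \in S); case: (v \in S).
Qed.

Lemma simple_edgeP {E f} : simple_edges E -> f \in E ->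
  exists u v, u != v /\ f = [set u; v].
Proof. by move=> sE /sE/eqP/cards2P[u [v [uv ->]]]; exists u, v. Qed.

Lemma simple_edge_mem {E f} v : simple_edges E -> f \in E -> v \in f ->
  exists2 w, w != v & f = [set v; w].
Proof.
move=> sE /(simple_edgeP sE)[x [y [xy ->]]]; rewrite !inE => /orP[]/eqP->.
  by exists y; rewrite // eq_sym.
by exists x => //; rewrite setUC.
Qed.

Lemma path_crosses {E a s} S :
  path (fun u v => [set u; v] \in E) a s -> (a \in S) (+) (last a s \in S) ->
  exists f, [/\ f \in E, crosses f S & on_path (a :: s) f].
Proof.
elim: s a => [|z s IH] a /=; first by rewrite addbb.
move=> /andP[azE pz] sep; have [cr|ncr] := boolP (crosses [set a; z] S).
  by exists [set a; z]; rewrite azE cr eqxx.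
move: ncr; rewrite crosses2 => /negPf ncr.
have [|f [fE fS fz]] := IH z pz.
  by move: ncr sep; case: (a \in S); case: (z \in S).
by exists f; split=> //; apply/orP; right.
Qed.

Lemma on_path_mem a s f x : on_path (a :: s) f -> x \in f -> x \in a :: s.
Proof.
elim: s a => [|z s IH] a //= /orP[/eqP<-|fz xf].
  by rewrite !inE => /orP[]/eqP->; rewrite eqxx ?orbT.
by rewrite in_cons IH ?orbT.
Qed.

Lemma connect_along_path {E a s} (r : rel T) :
  path (fun u v => [set u; v] \in E) a s ->
  (forall u v, [set u; v] \in E -> on_path (a :: s) [set u; v] -> r u v) ->
  connect r a (last a s).
Proof.
elim: s a => [|z s IH] a //= /andP[azE pz] sub.
apply: (connect_trans (y := z)); first by apply/connect1/sub; rewrite ?eqxx.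
by apply: IH => // u v uvE uvz; apply: sub => //; apply/orP; right.
Qed.

Lemma connect_spath {E} {r : rel T} {x y} :
  (forall u v, r u v -> [set u; v] \in E) -> connect r x y ->
  exists s, [/\ spath E x y (x :: s), path r x s
    & forall f, on_path (x :: s) f -> exists u v, f = [set u; v] /\ r u v].
Proof.
move=> rE /connectP[s0 /shortenP[s ps us _] ->]; exists s.
split=> //; first by apply/and4P; split=> //; apply: sub_path ps.
elim: s x ps {us} => [|z s IH] x //= /andP[xz pz] f /orP[/eqP<-|].
  by exists x, z.
exact: IH.
Qed.

(** After the path has used [f], a second crossing would use [f] again and so revisit one of its
    ends, which simplicity forbids. *)
Lemma spath_single_cut {E x y q f} S : spath E x y q -> on_path q f ->
  crosses f S -> (forall g, g \in E -> g != f -> ~~ crosses g S) ->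
  (x \in S) (+) (y \in S).
Proof.
case: q => [|a s] //= /and4P[/eqP<-{x} /eqP<-{y} pa ua] fq fS nS.
elim: s a pa ua fq => [|z s IH] a //= /andP[azE pz] /andP[az uz] fq.
have [azf|azf] := eqVneq [set a; z] f.
  have nz : ~~ ((z \in S) (+) (last z s \in S)).
    apply/negP => /(path_crosses _ pz)[g [gE gS gz]].
    have gf : g != f.
      by apply: contraNneq az => gf; apply: (on_path_mem z s g) => //; rewrite gf -azf !inE eqxx.
    by have := nS g gE gf; rewrite gS.
  move: fS nz; rewrite -azf crosses2.
  by case: (a \in S); case: (z \in S); case: (last z s \in S).
have := nS _ azE azf; rewrite crosses2 => naz.
move: fq; rewrite (negPf azf) /= => fz.
have := IH z pz uz fz; move: naz.
by case: (a \in S); case: (z \in S); case: (last z s \in S).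
Qed.

Definition adj_without E f : rel T := fun u v => [set u; v] \in E :\ f.

Lemma adj_without_sym E f : connect_sym (adj_without E f).
Proof. by apply: sym_connect_sym => u v; rewrite /adj_without setUC. Qed.

Lemma tree_bridge {E u v} : acyclic_graph E -> u != v -> [set u; v] \in E ->
  ~~ connect (adj_without E [set u; v]) u v.
Proof.
move=> acE uv uvE; apply/negP => /connectP[s0 /shortenP[s ps us _] vE].
apply: acE; exists u, s; split=> //.
- case: s ps vE {us} => [|z [|z' s]] //= ps vE; first by rewrite vE eqxx in uv.
  by move: ps; rewrite /adj_without -vE !inE eqxx.
- by apply: sub_path ps => x y; rewrite /adj_without !inE => /andP[].
- by rewrite -vE setUC.
Qed.

Lemma connected_crossed {E} S x y : connected_graph E ->
  x \in S -> y \notin S -> exists2 f, f \in E & crosses f S.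
Proof.
move=> cE xS yS; have [[|a s] //= /and4P[/eqP ax /eqP ly pa _]] := cE x y.
have [|f [fE fS _]] := path_crosses S pa; last by exists f.
by rewrite ly ax xS (negPf yS).
Qed.

(** The side of [f] away from [r], obtained by deleting [f], so that no parent relation is
    needed. *)
Definition below E (r : T) f : {set T} :=
  [set v | ~~ connect (adj_without E f) r v].

Lemma root_below E r f : r \notin below E r f.
Proof. by rewrite inE negbK. Qed.

(** * Rooted trees described by the sides of their edges *)

Section Rooted.
Context {E : {set {set T}}} (r : T) (treeE : is_tree E).
Implicit Types (h : {set T}).

Lemma crosses_below_neq f h : h \in E -> h != f -> ~~ crosses h (below E r f).
Proof.
case: treeE => _ sE _ _ hE hf; have [u [v [_ eh]]] := simple_edgeP sE hE.
have uv : adj_without E f u v by rewrite /adj_without -eh !inE hf.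
rewrite eh crosses2 !inE (same_connect_r (adj_without_sym E f) (connect1 uv)).
by rewrite addbb.
Qed.

(** The ends of [f] are not both on the root side, because [f] is a bridge, nor both below, because
    then no edge at all would leave [below E r f]. *)
Lemma crosses_below f : f \in E -> crosses f (below E r f).
Proof.
case: treeE => _ sE cE acE fE; have [u [v [uv ef]]] := simple_edgeP sE fE.
have br : ~~ connect (adj_without E f) u v.
  by rewrite ef; apply: tree_bridge => //; rewrite -ef.
apply: contraT => ncr.
have : u \in below E r f.
  apply: contraT => uB; move: (ncr); rewrite ef crosses2 -ef (negPf uB) /= => vB.
  move: uB vB; rewrite !inE !negbK => ru rv.
  by rewrite adj_without_sym in ru; rewrite (connect_trans ru rv) in br.
move=> /(connected_crossed _ _ r cE)/(_ (root_below E r f))[h hE hB].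
have [hf|hf] := eqVneq h f; first by rewrite hf (negPf ncr) in hB.
by have := crosses_below_neq f h hE hf; rewrite hB.
Qed.

Lemma on_path_below {x y q f} : spath E x y q -> f \in E ->
  on_path q f = (x \in below E r f) (+) (y \in below E r f).
Proof.
move=> pq fE; apply/idP/idP => [fq|].
  apply: (spath_single_cut _ pq fq (crosses_below f fE)) => g gE.
  exact: crosses_below_neq.
case: q pq => [|a s] // /and4P[/eqP<- /eqP<- pa _] sep.
have [g [gE gB ga]] := path_crosses _ pa sep.
by have [<-|gf] := eqVneq g f; rewrite // (negPf (crosses_below_neq f g gE gf)) in gB.
Qed.

Lemma below_inj x y :
  (forall f, f \in E -> (x \in below E r f) = (y \in below E r f)) -> x = y.
Proof.
case: (treeE) => _ _ cE _ same; have [[|a [|z s]] // pq] := cE x y.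
  by case/and4P: pq => /eqP<- /eqP<-.
have azE : [set a; z] \in E by case/and4P: pq => _ _ /=/andP[].
by have := on_path_below pq azE; rewrite same // addbb /= eqxx.
Qed.

(** If all three alternatives fail, [a], [c], [v] and [r] witness that the two sets cut the tree
    into four nonempty quadrants. Only [f] and [g] can join quadrants, and each joins just one pair,
    too few to connect all four. *)
Lemma below_laminar f g : f \in E -> g \in E ->
  [\/ below E r f \subset below E r g, below E r g \subset below E r f
    | [disjoint below E r f & below E r g]].
Proof.
move=> fE gE; have [<-|fg] := eqVneq f g; first by constructor 1.
set Bf := below E r f; set Bg := below E r g.
case: (boolP (Bf \subset Bg)) => [|/subsetPn[a af ag]]; first by constructor 1.
case: (boolP (Bg \subset Bf)) => [|/subsetPn[c cg cf]]; first by constructor 2.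
case: (boolP [disjoint Bf & Bg]) => [|/pred0Pn[v /andP[/= vf vg]]].
  by constructor 3.
case: (treeE) => _ sE cE _.
have [x [y [xy ef]]] := simple_edgeP sE fE.
have [u [w [uw eg]]] := simple_edgeP sE gE.
have rf : r \notin Bf := root_below E r f.
have rg : r \notin Bg := root_below E r g.
have nf h : h \in E -> h != f -> ~~ crosses h Bf by apply: crosses_below_neq.
have ng h : h \in E -> h != g -> ~~ crosses h Bg by apply: crosses_below_neq.
clearbody Bf Bg.
have := ng f fE fg; have := nf g gE; rewrite eq_sym => /(_ fg).
rewrite eg ef !crosses2.
(* [f] runs inside one side of [Bg] and [g] inside one side of [Bf], so neither
   of them reaches the opposite quadrant [Q]. *)
move=> gsame fsame.
pose Q := [set z | ((z \in Bf) (+) (u \in Bf)) && ((z \in Bg) (+) (x \in Bg))].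
have [z zQ] : exists z, z \in Q.
  case uf: (u \in Bf); case xg: (x \in Bg).
  - by exists r; rewrite inE uf xg (negPf rf) (negPf rg).
  - by exists c; rewrite inE uf xg (negPf cf) cg.
  - by exists a; rewrite inE uf xg (negPf ag) af.
  - by exists v; rewrite inE uf xg vf vg.
have xQ : x \notin Q by rewrite inE addbb andbF.
have [h hE] := connected_crossed Q z x cE zQ xQ.
have [s [t [_ eh]]] := simple_edgeP sE hE.
have [hf|hf] := eqVneq h f.
  rewrite hf ef crosses2 !inE; move: fsame.
  by case: (x \in Bg); case: (y \in Bg); rewrite ?andbF.
have [hg|hg] := eqVneq h g.
  rewrite hg eg crosses2 !inE; move: gsame.
  by case: (u \in Bf); case: (w \in Bf); rewrite ?andbF.
have := nf h hE hf; have := ng h hE hg; rewrite eh !crosses2 !inE.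
by case: (s \in Bf); case: (t \in Bf); case: (s \in Bg); case: (t \in Bg) => //=;
   case: (u \in Bf); case: (x \in Bg).
Qed.

End Rooted.
End GraphFacts.

(** * Max-flow min-cut *)

(** The step is the least ratio [s i / d i] over positive [d i]: no slack turns negative, the
    minimizer drops to 0, and by the second hypothesis zero slacks stay 0. *)
Lemma decrease_to_zero {R : realFieldType} {I : finType} (s d : I -> R) :
  (forall i, 0 <= s i) -> (forall i, s i = 0 -> d i = 0) ->
  (exists i, 0 < d i) ->
  exists eps, [/\ 0 <= eps, forall i, 0 <= s i - eps * d i
    & (#|[set i | (0 < s i - eps * d i)%R]| < #|[set i | (0 < s i)%R]|)%N].
Proof.
move=> s0 sd [i0 di0].
case: (@arg_minP _ R I i0 (fun i => 0 < d i) (fun i => s i / d i) di0) => i /= di imin.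
exists (s i / d i); set eps := s i / d i.
have eps0 : 0 <= eps by rewrite divr_ge0 // ltW.
have ge0 j : 0 <= s j - eps * d j.
  have [dj|dj] := ltP 0 (d j).
    by rewrite subr_ge0 -ler_pdivlMr //; apply: imin.
  by rewrite subr_ge0 (le_trans _ (s0 j)) // mulr_ge0_le0.
split=> //; apply/proper_card/properP; split.
  apply/subsetP => j; rewrite !inE => lt0; rewrite lt0r s0 andbT.
  by apply: contraTneq lt0 => sj; rewrite sj sd // mulr0 subr0 ltxx.
exists i; rewrite !inE.
  by rewrite lt0r s0 andbT; apply: contraTneq di => /sd ->; rewrite ltxx.
by rewrite /eps divfK ?subrr ?ltxx // gt_eqF.
Qed.

Section Cuts.
Context {R : realFieldType} {T : finType} {E : {set {set T}}}.
Hypothesis sE : simple_edges E.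
Implicit Types (b : {set T} -> R) (S f : {set T}).

Definition cutcap (E : {set {set T}}) b S : R :=
  \sum_(f in E) b f * (crosses f S)%:R.

(** This and posimodularity hold for each edge separately, by the positions of its two ends. *)
Lemma cutcap_submod b S S' : (forall f, f \in E -> 0 <= b f) ->
  cutcap E b (S :&: S') + cutcap E b (S :|: S') <= cutcap E b S + cutcap E b S'.
Proof.
move=> b0; rewrite -!big_split /=; apply: ler_sum => f fE.
rewrite -!mulrDr ler_wpM2l ?b0 //.
have [u [v [_ ->]]] := simple_edgeP sE fE.
rewrite -!natrD ler_nat !crosses2 !inE.
by case: (u \in S); case: (v \in S); case: (u \in S'); case: (v \in S').
Qed.

Lemma cutcap_posimod b S S' : (forall f, f \in E -> 0 <= b f) ->
  cutcap E b (S :\: S') + cutcap E b (S' :\: S) <= cutcap E b S + cutcap E b S'.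
Proof.
move=> b0; rewrite -!big_split /=; apply: ler_sum => f fE.
rewrite -!mulrDr ler_wpM2l ?b0 //.
have [u [v [_ ->]]] := simple_edgeP sE fE.
rewrite -!natrD ler_nat !crosses2 !inE.
by case: (u \in S); case: (v \in S); case: (u \in S'); case: (v \in S').
Qed.

Context {A B : {set T}}.
Definition separates S := (A \subset S) && (S \subset ~: B).

(** * Minimum cuts and the orientation they induce *)

Section Tight.
Variables (b : {set T} -> R) (lam : R).
Hypothesis b0 : forall f, f \in E -> 0 <= b f.
Hypothesis lamP : forall S, separates S -> lam <= cutcap E b S.

Definition tight S := separates S && (cutcap E b S == lam).

Lemma separatesI S S' : separates S -> separates S' -> separates (S :&: S').
Proof.
move=> /andP[AS SB] /andP[AS' _]; apply/andP; split; first by rewrite subsetI AS.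
exact: subset_trans (subsetIl _ _) SB.
Qed.

Lemma separatesU S S' : separates S -> separates S' -> separates (S :|: S').
Proof.
move=> /andP[AS SB] /andP[_ SB']; apply/andP; split.
  exact: subset_trans AS (subsetUl _ _).
by rewrite subUset SB.
Qed.

Lemma tightU S S' : tight S -> tight S' -> tight (S :|: S').
Proof.
move=> /andP[sS /eqP cS] /andP[sS' /eqP cS'].
have sU := separatesU _ _ sS sS'; have sI := separatesI _ _ sS sS'.
rewrite /tight sU eq_le lamP // andbT.
have := cutcap_submod _ S S' b0; have := lamP _ sI; rewrite cS cS'; lra.
Qed.

(** Such an edge counts in both [S] and [S'] but in neither their intersection nor their union.
    Submodularity then has [2 * b [set u; v]] to spare, while tightness leaves no room. *)
Lemma tight_no_opposite S S' u v : tight S -> tight S' ->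
  u \in S -> v \notin S -> v \in S' -> u \notin S' -> [set u; v] \in E ->
  b [set u; v] <= 0.
Proof.
move=> /andP[sS /eqP cS] /andP[sS' /eqP cS'] uS vS vS' uS' uvE.
have := lamP _ (separatesI _ _ sS sS'); have := lamP _ (separatesU _ _ sS sS').
suff : cutcap E b (S :&: S') + cutcap E b (S :|: S') + 2 * b [set u; v]
       <= cutcap E b S + cutcap E b S' by rewrite cS cS'; lra.
rewrite /cutcap -!big_split /= !(bigD1 _ uvE) /=.
rewrite !crosses2 !inE uS (negPf vS) vS' (negPf uS') /=.
set I := bigop _ _ _; set J := bigop _ _ _; suff : I <= J by lra.
apply: ler_sum => f /andP[fE _]; rewrite -!mulrDr ler_wpM2l ?b0 //.
have [x [y [_ ->]]] := simple_edgeP sE fE.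
rewrite -!natrD ler_nat !crosses2 !inE.
by case: (x \in S); case: (y \in S); case: (x \in S'); case: (y \in S') => /=;
   rewrite ?addr0 ?add0r ?lerDl ?ler01.
Qed.

(* Orients the positive edges: by [tight_no_opposite] no such edge leaves one
   tight cut and enters another. *)
Definition arc : rel T := fun u v =>
  [&& [set u; v] \in E, 0 < b [set u; v]
    & [exists S, [&& tight S, u \in S & v \notin S]]].

Lemma arc_tight u v S : arc u v -> tight S -> v \in S -> u \in S.
Proof.
case/and3P=> uvE bpos /existsP[S' /and3P[tS' uS' vS']] tS vS.
apply: contraTT bpos => uS; rewrite -leNgt.
exact: (tight_no_opposite S' S).
Qed.

Hypothesis all_tight : forall f, f \in E -> 0 < b f ->
  exists2 S, tight S & crosses f S.

Lemma arc_orient u v : [set u; v] \in E -> 0 < b [set u; v] -> arc u v || arc v u.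
Proof.
move=> uvE bpos; have [S tS] := all_tight _ uvE bpos; rewrite crosses2.
rewrite /arc [X in _ || X]/= (setUC [set v]) uvE bpos /=.
case uS: (u \in S); case vS: (v \in S) => //= _; apply/orP; [left|right].
  by apply/existsP; exists S; rewrite tS uS vS.
by apply/existsP; exists S; rewrite tS uS vS.
Qed.

(* Take a largest tight [S] with [u] inside and [v] outside: without an arc out
   of [v], adding [v] to [S] would give a cut below [lam]. *)
Lemma arc_forward u v : arc u v -> v \notin B -> exists w, arc v w.
Proof.
case/and3P=> uvE bpos /existsP[S0 S0P] vB; apply: contrapT => noarc.
case: (@arg_maxnP _ S0 (fun S => [&& tight S, u \in S & v \notin S])
  (fun S => #|S|) S0P) => S /and3P[tS uS vS] maxS.
have sSv : separates (v |: S).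
  case/andP: tS => /andP[AS SB] _; apply/andP; split.
    exact: subset_trans AS (subsetUr _ _).
  by rewrite subUset sub1set inE vB.
have := lamP _ sSv; apply/negP; rewrite -ltNge.
have /andP[_ /eqP<-] := tS; rewrite /cutcap (bigD1 _ uvE) [ltRHS](bigD1 _ uvE) /=.
rewrite !crosses2 !inE uS (negPf vS) eqxx orbT /= mulr0 mulr1 ltr_leD //.
apply: ler_sum => g /andP[gE _].
have [vg|vg] := boolP (v \in g); last first.
  have [x [y [_ eg]]] := simple_edgeP sE gE.
  move: vg; rewrite eg !inE negb_or !crosses2 !inE => /andP[vx vy].
  by rewrite (eq_sym x) (eq_sym y) (negPf vx) (negPf vy).
have [w wv eg] := simple_edge_mem v sE gE vg.
rewrite eg !crosses2 !inE eqxx (negPf wv) (negPf vS) /=.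
case wS: (w \in S) => /=; first by rewrite mulr0 mulr1 b0 // -eg.
(* A positive edge from [v] to a [w] outside [S] would be an arc from [w] to [v]. The union of [S]
   with the tight cut behind that arc would contradict the maximality of [S]. *)
rewrite mulr0 mulr1 leNgt; apply/negP => bw.
have vwE : [set v; w] \in E by rewrite -eg.
have /orP[vw|] := arc_orient v w vwE bw; first by apply: noarc; exists w.
case/and3P=> _ _ /existsP[S' /and3P[tS' wS' vS']].
have := maxS (S :|: S'); rewrite tightU // !inE uS (negPf vS) /= => /(_ vS').
apply/negP; rewrite -ltnNge proper_card //; apply/properP; split.
  exact: subsetUl.
by exists w; rewrite ?inE ?wS' ?wS ?orbT.
Qed.

(* Every arc strictly decreases the number of tight cuts around its end, so
   following arcs forward must stop, and it can only stop in [B]. *)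
Lemma arc_reach u v : arc u v -> exists2 t, t \in B & connect arc v t.
Proof.
have [n] := ubnP #|[set S | tight S && (v \in S)]|.
elim: n u v => // n IH u v ltn uv.
have [vB|vB] := boolP (v \in B); first by exists v.
have [w vw] := arc_forward u v uv vB.
have [|t tB wt] := IH v w _ vw; last first.
  by exists t => //; apply: connect_trans wt; apply: connect1.
rewrite ltnS in ltn; apply: leq_trans ltn; apply/proper_card/properP; split.
  apply/subsetP => S; rewrite !inE => /andP[tS wS].
  by rewrite tS (arc_tight _ _ _ vw).
case/and3P: vw => _ _ /existsP[S /and3P[tS vS wS]].
by exists S; rewrite !inE tS ?vS // (negPf wS).
Qed.

(** [A] is itself a separating cut, so with [lam] positive some positive edge leaves it. A tight cut
    crossed by this edge contains [A], which makes the edge an arc out of [A]; arcs can then be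
    followed to [B]. *)
Lemma arc_path : [disjoint A & B] -> 0 < lam ->
  exists x y s, [/\ x \in A, y \in B, spath E x y (x :: s) & path arc x s].
Proof.
move=> AB lam0.
have sA : separates A by rewrite /separates subxx -disjoints_subset.
have [f fE fA] : exists2 f, f \in E & 0 < b f * (crosses f A)%:R.
  apply: contrapT => nof; have := lt_le_trans lam0 (lamP _ sA); apply/negP.
  rewrite -leNgt; apply: sumr_le0 => f fE; rewrite leNgt; apply/negP => fA.
  by apply: nof; exists f.
have [u [v [_ ef]]] := simple_edgeP sE fE.
have cr : crosses f A by move: fA; case: crosses => //; rewrite mulr0 ltxx.
have bf : 0 < b f by move: fA; rewrite cr mulr1.
wlog [uA vA] : u v ef / u \in A /\ v \notin A.
  move=> wl; move: (cr); rewrite ef crosses2 => uv.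
  have [uA|uA] := boolP (u \in A).
    by apply: (wl u v) => //; split=> //; move: uv; rewrite uA.
  apply: (wl v u); first by rewrite setUC.
  by split=> //; move: uv; rewrite (negPf uA).
have uv : arc u v.
  rewrite /arc -ef fE bf /=; have [S tS fS] := all_tight f fE bf.
  apply/existsP; exists S; move: fS; rewrite tS ef crosses2.
  case/andP: tS => /andP[/subsetP AS _] _.
  by rewrite (AS u).
have [t tB vt] := arc_reach u v uv.
have [s [sp pa _]] := connect_spath
  (fun x y (h : arc x y) => proj1 (andP h)) (connect_trans (connect1 uv) vt).
by exists u, t, s.
Qed.

(** No arc enters a tight cut, so once the path has left [S] it never returns. *)
Lemma arc_path_cross S a s : tight S -> path arc a s -> a \in S -> last a s \notin S ->
  \sum_(f in E) (on_path (a :: s) f)%:R * (crosses f S)%:R = 1 :> R.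
Proof.
move=> tS pa aS lS.
have [f0 [f0E f0S f0P] uniqf] : exists2 f0,
    [/\ f0 \in E, crosses f0 S & on_path (a :: s) f0]
    & forall f, crosses f S -> on_path (a :: s) f -> f = f0.
  elim: s a pa aS lS => [|z s IH] a /=; first by move=> _ ->.
  move=> /andP[az pz] aS lS; have azE : [set a; z] \in E by case/and3P: az.
  have [zS|zS] := boolP (z \in S).
    have [f0 [? ? f0P] uf] := IH z pz zS lS.
    exists f0; first by split=> //; apply/orP; right.
    by move=> f fS /orP[/eqP ef|]; [move: fS; rewrite -ef crosses2 aS zS | exact: uf].
  exists [set a; z]; first by rewrite azE crosses2 aS (negPf zS) eqxx.
  move=> f fS /orP[/eqP-> //|fz]; exfalso.
  elim: s z pz zS fz {IH lS az azE} => [|y s IH] z //= /andP[zy py] zS.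
  have yS : y \notin S by apply: contraNN zS; apply: arc_tight.
  move=> /orP[/eqP ef|]; last exact: IH.
  by move: fS; rewrite -ef crosses2 (negPf zS) (negPf yS).
rewrite (bigD1 _ f0E) f0S f0P mulr1 big1; first exact: addr0.
move=> f /andP[_ ff0].
case fP: (on_path _ f); rewrite ?mul0r //; case fS: (crosses f S); rewrite ?mulr0 //.
by rewrite (uniqf f fS fP) eqxx in ff0.
Qed.

End Tight.

(** Edge and cut constraints share one index type, so that their positive slacks can be counted
    together. Indices that stand for no constraint get 0 and are never counted. *)
Definition slack b lam (k : {set T} + {set T}) : R :=
  match k with
  | inl f => if f \in E then b f else 0
  | inr X => if separates X then cutcap E b X - lam else 0
  end.

(* Used with [Q] a single edge outside all tight cuts and [delta = 0], or [Q] an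
   [A]-[B] path meeting every tight cut once and [delta = 1]. *)
Lemma reduce_capacity b lam (Q : pred {set T}) (delta : R) :
  (forall f, f \in E -> 0 <= b f) ->
  (forall S, separates S -> lam <= cutcap E b S) ->
  (exists2 f, f \in E & Q f) ->
  (forall f, f \in E -> Q f -> 0 < b f) ->
  (forall S, tight b lam S ->
     \sum_(f in E) (Q f)%:R * (crosses f S)%:R = delta) ->
  exists eps (b' := fun f => b f - eps * (Q f)%:R) (lam' := lam - eps * delta),
  [/\ 0 <= eps, forall f, f \in E -> 0 <= b' f,
      forall S, separates S -> lam' <= cutcap E b' S
    & (#|[set k | (0 < slack b' lam' k)%R]| < #|[set k | (0 < slack b lam k)%R]|)%N].
Proof.
move=> b0 lamP [f0 f0E Qf0] Qpos Qtight.
(* [d k] is the rate at which the slack [k] falls as [eps] grows; for a cut, the loss of capacity is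
   offset by the fall of [lam]. *)
pose d (k : {set T} + {set T}) : R := match k with
  | inl f => if f \in E then (Q f)%:R else 0
  | inr X => if separates X
      then \sum_(f in E) (Q f)%:R * (crosses f X)%:R - delta else 0
  end.
have s0 k : 0 <= slack b lam k.
  case: k => [f|S] /=; case: ifP => // h; first exact: b0.
  by rewrite subr_ge0 lamP.
have sd k : slack b lam k = 0 -> d k = 0.
  case: k => [f|S] /=; case: ifP => // h.
    case Qf: (Q f) => // bf; by have := Qpos f h Qf; rewrite bf ltxx.
  move/eqP; rewrite subr_eq0 => cS.
  by rewrite Qtight ?subrr // /tight h cS.
have [|eps [eps0 ge0 card]] := decrease_to_zero _ d s0 sd.
  by exists (inl f0); rewrite /= f0E Qf0.
exists eps => b' lam'.
have sE' k : slack b' lam' k = slack b lam k - eps * d k.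
  case: k => [f|S] /=; case: ifP => // h; rewrite ?mulr0 ?subr0 //.
  have -> : cutcap E b' S = cutcap E b S -
      eps * \sum_(f in E) (Q f)%:R * (crosses f S)%:R.
    rewrite /cutcap mulr_sumr -sumrB; apply: eq_bigr => f _.
    by rewrite /b' mulrBl mulrA.
  rewrite /lam'; lra.
split=> //.
- by move=> f fE; have := ge0 (inl f); rewrite -sE' /= fE.
- by move=> S sS; have := ge0 (inr S); rewrite -sE' /= sS subr_ge0.
- apply: leq_ltn_trans card; apply: subset_leq_card.
  by apply/subsetP => k; rewrite !inE sE'.
Qed.

(** The flow is a list of weighted simple paths, ready to be read as demands. Since [lam] is only a
    lower bound on the cuts, it can decrease together with [b] in the induction. *)
Lemma max_flow_min_cut b lam :
  [disjoint A & B] -> (forall f, f \in E -> 0 <= b f) ->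
  (forall S, separates S -> lam <= cutcap E b S) ->
  exists L : seq (R * seq T),
    [/\ forall t, t \in L -> 0 <= t.1 /\
          exists x y, [/\ x \in A, y \in B & spath E x y t.2],
        lam <= \sum_(t <- L) t.1
      & forall f, f \in E -> \sum_(t <- L | on_path t.2 f) t.1 <= b f].
Proof.
move=> AB; have [n] := ubnP #|[set k | 0 < slack b lam k]|.
elim: n b lam => // n IH b lam; rewrite ltnS => ltn b0 lamP.
have [lam0|lam0] := leP lam 0.
  by exists [::]; split=> [//||f fE]; rewrite big_nil // b0.
have [at_|] := pselect (forall f, f \in E -> 0 < b f ->
  exists2 S, tight b lam S & crosses f S); last first.
  move=> /existsNP[f0 /not_implyP[f0E /not_implyP[bf0 not_]]].
  have [|||eps [eps0 b'0 lam'P card]] :=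
    reduce_capacity b lam (pred1 f0) 0 b0 lamP.
  - by exists f0 => //=.
  - by move=> f _ /eqP->.
  - move=> S tS; rewrite big1 // => f _ /=; have [->|] := eqVneq f f0; last by rewrite mul0r.
    case cr: crosses; rewrite ?mulr0 //; exfalso; apply: not_.
    by exists S => //; rewrite cr.
  have [L [L1 L2 L3]] := IH _ _ (leq_trans card ltn) b'0 lam'P.
  exists L; split=> //; first by move: L2; rewrite mulr0 subr0.
  move=> f fE; apply: le_trans (L3 f fE) _.
  by rewrite lerBlDr lerDl mulr_ge0 ?ler0n.
have [x [y [s [xA yB sp pa]]]] := arc_path b lam b0 lamP at_ AB lam0.
have paE : path (fun u v => [set u; v] \in E) x s by case/and4P: sp.
have lsy : last x s = y by case/and4P: sp => _ /eqP.
have [|||eps [eps0 b'0 lam'P card]] :=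
  reduce_capacity b lam (on_path (x :: s)) 1 b0 lamP.
- have xy : (x \in A) (+) (last x s \in A).
    by rewrite xA lsy (disjointFl AB).
  by have [f [fE _ fs]] := path_crosses A paE xy; exists f.
- move=> f _; elim: s x pa {xA sp paE lsy} => [|z s IHs] x //= /andP[xz pz].
  by move=> /orP[/eqP<-|]; [case/and3P: xz | exact: IHs].
- move=> S tS; apply: (arc_path_cross b lam b0 lamP) => //.
    by case/andP: tS => /andP[/subsetP AS _] _; apply: AS.
  case/andP: tS => /andP[_ /subsetP SB] _.
  by rewrite lsy; apply: contraTN yB => /SB; rewrite inE.
have [L [L1 L2 L3]] := IH _ _ (leq_trans card ltn) b'0 lam'P.
(* Routing [eps] along the path makes up for what was taken from [lam] and from the capacities on
   the path. *)
exists ((eps, x :: s) :: L); split.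
- move=> t; rewrite in_cons => /orP[/eqP->|]; last exact: L1.
  by split=> //; exists x, y.
- by rewrite big_cons /=; move: L2; rewrite mulr1 lerBlDl.
- move=> f fE; rewrite big_cons [(_, _).1]/= [(_, _).2]/=.
  have := L3 f fE.
  case: ifP => _; last by rewrite mulr0 subr0.
  by rewrite mulr1 lerBrDl.
Qed.

End Cuts.

(** * Hub trees *)

Lemma set2_eq {T : finType} (x y v w : T) : [set x; y] = [set v; w] ->
  (x = v /\ y = w) \/ (x = w /\ y = v).
Proof.
move=> eq_xy.
have : x \in [set v; w] by rewrite -eq_xy !inE eqxx.
have : y \in [set v; w] by rewrite -eq_xy !inE eqxx orbT.
have : v \in [set x; y] by rewrite eq_xy !inE eqxx.
have : w \in [set x; y] by rewrite eq_xy !inE eqxx orbT.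
by rewrite !inE => /orP[]/eqP e1 /orP[]/eqP e2 /orP[]/eqP e3 /orP[]/eqP e4; subst; tauto.
Qed.

Section Terminals.
Context {R : realType} {V : finType} (W : {set V}).
Implicit Types (D : {set V} -> R) (X p : {set V}).

Lemma pairsP p : p \in pairs W ->
  exists i j, [/\ i \in W, j \in W & p = [set i; j]].
Proof.
rewrite inE => /andP[pW /cards2P[i [j [_ ep]]]]; exists i, j.
by split=> //; apply: (subsetP pW); rewrite ep !inE eqxx ?orbT.
Qed.

Definition across D X : R := \sum_(p in pairs W) D p * (crosses p X)%:R.

Section HubLoad.
Context {T : finType} {E : {set {set T}}} (iota : V -> T) (r : T).
Hypothesis treeE : is_tree E.

Definition shore f : {set V} := [set i in W | iota i \in below E r f].

(** By [on_path_below] the use of [f] depends only on the ends, so neither the path nor the order of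
    the two terminals matters. *)
Lemma tpath_edgeE p f : p \in pairs W -> f \in E ->
  tpath_edge E iota p f <-> crosses p (shore f).
Proof.
move=> /pairsP[i [j [iW jW ep]]] fE.
have -> : crosses p (shore f) = crosses p (iota @^-1: below E r f).
  by rewrite ep !crosses2 !inE iW jW.
split=> [[i' [j' [-> [q [pq fq]]]]]|].
  by have := on_path_below r treeE pq fE; rewrite fq crosses2 !in_set => <-.
rewrite ep crosses2 !in_set => sep; exists i, j; split=> //.
case: (treeE) => _ _ cE _; have [q pq] := cE (iota i) (iota j).
by exists q; split=> //; rewrite (on_path_below r treeE pq fE) !in_set.
Qed.

Lemma loadE D f : f \in E -> load W E iota D f = across D (shore f).
Proof.
move=> fE; apply: eq_bigr => p pW; case: asboolP => tp.
  by rewrite (proj1 (tpath_edgeE p f pW fE) tp) mulr1.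
case cr: (crosses p (shore f)); last by rewrite mulr0.
by case: tp; apply/(tpath_edgeE p f pW fE); rewrite cr.
Qed.

End HubLoad.

(** * Demands and cuts in the capacitated tree *)

Section CapacitatedTree.
Context {T : finType} {E : {set {set T}}} (iota : V -> T) (b : {set T} -> R).
Hypothesis treeE : is_tree E.
Hypothesis iota_inj : {in W &, injective iota}.
Hypothesis b0 : forall f, f \in E -> 0 <= b f.
Implicit Types (S : {set T}).

Definition cuts X S : bool := [forall i in W, (iota i \in S) == (i \in X)].

Lemma cutsP X S : reflect {in W, forall i, (iota i \in S) = (i \in X)} (cuts X S).
Proof. exact: 'forall_in_eqP. Qed.

(** Weak duality: the tree path of a pair across [X] contains an edge crossing [S], so its demand is
    counted when the loads of the cut edges are summed. *)
Lemma across_le_cut D X S : UTb W E iota b D -> cuts X S ->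
  across D X <= cutcap E b S.
Proof.
move=> [D0 Db] /cutsP SX; case: (treeE) => _ _ cE _.
apply: (@le_trans _ _ (\sum_(f in E) load W E iota D f * (crosses f S)%:R)).
  under [leRHS]eq_bigr do rewrite mulr_suml.
  rewrite exchange_big /=; apply: ler_sum => p pW.
  have F0 f : 0 <= (if `[< tpath_edge E iota p f >] then D p else 0) * (crosses f S)%:R.
    by rewrite mulr_ge0 ?ler0n //; case: ifP => // _; apply: D0.
  have [i [j [iW jW ep]]] := pairsP p pW.
  case cr: (crosses p X); last by rewrite mulr0 sumr_ge0.
  have [[|a s] // pq] := cE (iota i) (iota j).
  have /and4P[/eqP ai /eqP lj pa _] := pq.
  have [|f [fE fS fa]] := path_crosses S pa.
    by rewrite lj ai !SX // -crosses2 -ep.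
  rewrite (bigD1 f) //= fS !mulr1 asboolT ?lerDl ?sumr_ge0 //.
  by exists i, j; split=> //; exists (a :: s).
by apply: ler_sum => f fE; rewrite ler_wpM2r ?ler0n ?Db.
Qed.

(** Take a flow of value at least [lam] from the terminals in [X] to the others and read each path
    as a demand between its ends. As the use of a tree edge depends only on the ends, loads equal
    the flow on the edges. *)
Lemma across_ge_cut X lam : (forall S, cuts X S -> lam <= cutcap E b S) ->
  exists D, UTb W E iota b D /\ lam <= across D X.
Proof.
move=> lamP; case: (treeE) => /card_gt0P[r _] sE _ _.
pose A := iota @: (W :&: X); pose B := iota @: (W :\: X).
have AB : [disjoint A & B].
  apply/pred0Pn => -[x /andP[/imsetP[i]]]; rewrite inE => /andP[iW iX] ->.
  case/imsetP=> j; rewrite inE => /andP[jX jW] eij.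
  by rewrite -(iota_inj i j iW jW eij) iX in jX.
have cutsAB S : @separates T A B S -> lam <= cutcap E b S.
  move=> /andP[/subsetP AS /subsetP SB]; apply/lamP/cutsP => i iW.
  have [iX|iX] := boolP (i \in X).
    by apply: AS; apply: imset_f; rewrite inE iW.
  apply: negbTE; apply/negP => /SB; rewrite inE; apply/negP; rewrite negbK.
  by apply: imset_f; rewrite inE iX.
have [L [LP Llam Lb]] := max_flow_min_cut sE b lam AB b0 cutsAB.
have [|pr prP] := @choice (R * seq T) {set V} (fun t p => t \in L ->
    exists i j, [/\ p = [set i; j], i \in W :&: X, j \in W :\: X
                  & spath E (iota i) (iota j) t.2]).
  move=> t.
  have [tL|_] := boolP (t \in L); last by exists set0.
  have [_ [x [y [/imsetP[i iX ->] /imsetP[j jX ->] sp]]]] := LP t tL.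
  by exists [set i; j] => _; exists i, j.
pose D p : R := \sum_(t <- L) (if p == pr t then t.1 else 0).
have prW t : t \in L -> pr t \in pairs W.
  move=> /prP[i [j [-> iX jX _]]]; move: iX jX.
  rewrite !inE subUset !sub1set => /andP[-> iX] /andP[jX ->] /=.
  by rewrite cards2 (_ : i != j) //; apply: contraNneq jX => <-.
have D0 p : 0 <= D p.
  rewrite /D big_seq sumr_ge0 // => t tL; case: ifP => // _.
  by case: (LP t tL).
have acrossD Y : across D Y = \sum_(t <- L) t.1 * (crosses (pr t) Y)%:R.
  rewrite /across; under eq_bigr do rewrite mulr_suml.
  rewrite exchange_big /= big_seq [RHS]big_seq; apply: eq_bigr => t tL.
  rewrite (bigD1 (pr t)) ?prW //= eqxx big1 ?addr0 // => p /andP[_ /negPf->].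
  by rewrite mul0r.
exists D; split; last first.
  rewrite acrossD; apply: le_trans Llam _; rewrite big_seq [leRHS]big_seq.
  apply: ler_sum => t /prP[i [j [-> ]]]; rewrite !inE => /andP[_ iX] /andP[jX _] _.
  by rewrite crosses2 iX (negPf jX) mulr1.
split=> [p _|f fE]; first exact: D0.
rewrite (loadE iota r treeE) // acrossD; apply: le_trans (Lb f fE).
rewrite [leRHS]big_mkcond /= big_seq [leRHS]big_seq; apply: ler_sum => t tL.
have [i [j [-> iX jX sp]]] := prP t tL; rewrite (on_path_below r treeE sp fE).
move: iX jX; rewrite inE => /andP[iW _]; rewrite inE => /andP[_ jW].
by rewrite crosses2 !in_set iW jW /=; case: ifP => _; rewrite ?mulr1 ?mulr0.
Qed.

(* Taking the smallest minimum cuts makes them inherit inclusion and disjointness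
   from the terminal sets that they cut off. *)
Definition smallest_mincut X S :=
  [/\ cuts X S, forall S', cuts X S' -> cutcap E b S <= cutcap E b S'
    & forall S', cuts X S' -> cutcap E b S' <= cutcap E b S -> (#|S| <= #|S'|)%N].

Lemma smallest_mincut_exists X : exists S, smallest_mincut X S.
Proof.
have cut0 : cuts X (iota @: (W :&: X)).
  apply/cutsP => i iW; apply/imsetP/idP => [[j]|iX].
    by rewrite inE => /andP[jW jX] /(iota_inj i j iW jW)->.
  by exists i; rewrite // inE iW.
case: (@arg_minP _ R _ _ (cuts X) (cutcap E b) cut0) => S1 cut1 min1.
have P1 : cuts X S1 && (cutcap E b S1 <= cutcap E b S1) by rewrite cut1 lexx.
case: (@arg_minnP _ S1 (fun S => cuts X S && (cutcap E b S <= cutcap E b S1))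
  (fun S => #|S|) P1) => S /andP[cutS le1] minS.
exists S; split=> // S' cutS'; first exact: le_trans le1 (min1 _ cutS').
by move=> le'; apply: minS; rewrite cutS' (le_trans le').
Qed.

Section Laminar.
Variables (X Y : {set V}) (S S' : {set T}).
Hypotheses (SX : smallest_mincut X S) (SY : smallest_mincut Y S').

(** The intersection cuts off [X] and the union cuts off [Y]. By submodularity the intersection is
    again a minimum cut for [X], and by cardinality it is all of [S]. *)
Lemma smallest_mincut_mono : X \subset Y -> S \subset S'.
Proof.
case: (treeE) SX SY => _ sE _ _ [/cutsP cX minX cardX] [/cutsP cY minY _] /subsetP XY.
have cutI : cuts X (S :&: S').
  apply/cutsP => i iW; rewrite inE cX // cY //.
  by case iX: (i \in X) => //=; apply: XY.
have cutU : cuts Y (S :|: S').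
  apply/cutsP => i iW; rewrite inE cX // cY //.
  by case iX: (i \in X) => //=; rewrite XY.
have := cardX _ cutI; have := minY _ cutU; have := cutcap_submod sE b S S' b0.
move=> sub le1 card; suff /eqP <- : S :&: S' == S by apply: subsetIr.
by rewrite eqEcard subsetIl card //; lra.
Qed.

(** The same argument with the two differences and posimodularity gives [S :\: S' = S]. *)
Lemma smallest_mincut_disjoint : [disjoint X & Y] -> [disjoint S & S'].
Proof.
case: (treeE) SX SY => _ sE _ _ [/cutsP cX minX cardX] [/cutsP cY minY _] XY.
have cutX : cuts X (S :\: S').
  apply/cutsP => i iW; rewrite inE cX // cY //.
  by case iX: (i \in X); rewrite ?andbF // (disjointFr XY).
have cutY : cuts Y (S' :\: S).
  apply/cutsP => i iW; rewrite inE cX // cY //.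
  by case iX: (i \in X) => //; rewrite (disjointFr XY).
have := cardX _ cutX; have := minY _ cutY; have := cutcap_posimod sE b S S' b0.
move=> sub le1 card; rewrite disjoints_subset -setD_eq0 setDE setCK.
suff /eqP eS : S :\: S' == S by rewrite -eS setDE -setIA (setIC (~: S')) setICr setI0.
by rewrite eqEcard subDset subsetUr card //; lra.
Qed.

End Laminar.

Context {M : {set V} -> {set T}} (MP : forall X, smallest_mincut X (M X)).

(** * Mapping the capacitated tree into another tree *)

Section TargetTree.
Context {T' : finType} {E' : {set {set T'}}} (iota' : V -> T') (r' : T').
Hypothesis treeE' : is_tree E'.
Local Notation below' := (below E' r').
Local Notation shore' := (@shore T' E' iota' r').

Lemma is_beta_mincut :
  is_beta W (UTb W E iota b) E' iota' (fun f => cutcap E b (M (shore' f))).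
Proof.
move=> f fE; have [cutM minM _] := MP (shore' f).
have le D : UTb W E iota b D -> load W E' iota' D f <= cutcap E b (M (shore' f)).
  by move=> UD; rewrite (loadE iota' r' treeE' D f fE); apply: across_le_cut.
split=> //; have [D [UD geD]] := across_ge_cut _ _ minM.
exists D; split=> //; apply/eqP; rewrite eq_le le //=.
by rewrite (loadE iota' r' treeE' D f fE).
Qed.

(** Among the edges whose minimum cut contains [v], take [f] with the smallest side below it and let
    [x] be its lower end; if there is none, take the root. Laminarity of the sides, inherited by the
    cuts, settles every other edge. *)
Lemma vertex_of_mincuts v :
  exists x, forall f, f \in E' -> (x \in below' f) = (v \in M (shore' f)).
Proof.
have shoreS f g : below' f \subset below' g -> shore' f \subset shore' g.
  move=> /subsetP fg; apply/subsetP => i /setIdP[iW /fg ig].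
  by apply/setIdP.
have [[f0 f0P]|nof] := pselect (exists f, (f \in E') && (v \in M (shore' f))); last first.
  exists r' => f fE; rewrite (negPf (root_below E' r' f)); apply/esym/negP => vM.
  by apply: nof; exists f; rewrite fE.
case: (@arg_minnP _ f0 (fun f => (f \in E') && (v \in M (shore' f)))
  (fun f => #|below' f|) f0P) => f /andP[fE vf] minf.
have /andP[/set0Pn[x /setIP[xf xB]] /subsetPn[y yf yB]] := crosses_below r' treeE' f fE.
exists x => g gE; apply/idP/idP => [xg|vg].
  have [->//|gf] := eqVneq g f; have fg : f != g by rewrite eq_sym.
  case: (below_laminar r' treeE' f g fE gE) => [sub|/subsetP sub|dis].
  - exact: subsetP (smallest_mincut_mono _ _ _ _ (MP _) (MP _) (shoreS _ _ sub)) _ vf.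
  - case/negP: (crosses_below_neq r' treeE' g f fE fg); apply/andP; split.
      by apply/set0Pn; exists x; rewrite inE xf.
    by apply/subsetPn; exists y => //; apply: contraNN yB => /sub.
  - by rewrite (disjointFr dis xB) in xg.
case: (below_laminar r' treeE' f g fE gE) => [/subsetP->//|sub|dis].
  suff /eqP -> : below' g == below' f by [].
  by rewrite eqEcard sub minf // gE vg.
have dis' : [disjoint shore' f & shore' g].
  apply/pred0Pn => -[i /andP[/setIdP[_ fi] /setIdP[_]]].
  by rewrite (disjointFr dis fi).
have := smallest_mincut_disjoint _ _ _ _ (MP _) (MP _) dis'.
by move/disjointFr/(_ vf); rewrite vg.
Qed.

(** The images of consecutive tree edges concatenate only to a walk. Hence connectivity within the
    union of the images is shown first, and a simple path is extracted from it. *)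
Lemma edge_route {G : {set {set V}}} {phiv' : T' -> V} {phie' : {set T'} -> seq V}
    (g : {set T'} -> bool) (x y : T') :
  embedding W G E' iota' phiv' phie' ->
  (forall f, f \in E' -> (x \in below' f) (+) (y \in below' f) -> g f) ->
  exists q, spath G (phiv' x) (phiv' y) q /\
    forall e, on_path q e -> exists f, [/\ f \in E', g f & on_path (phie' f) e].
Proof.
move=> [_ embE] sepg; case: (treeE') => _ _ cE _.
pose used : rel V := fun u v => ([set u; v] \in G) &&
  [exists f, [&& f \in E', g f & on_path (phie' f) [set u; v]]].
have used_sym : connect_sym used.
  by apply: sym_connect_sym => u v; rewrite /used setUC.
have step a z : [set a; z] \in E' -> g [set a; z] -> connect used (phiv' a) (phiv' z).
  move=> azE gaz; have [v [w [eaz]]] := embE _ azE.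
  move: (eaz); case q0: (phie' _) => [|c s] // /set2_eq az.
  case/and4P => /eqP cv /eqP lw pc _.
  have vw : connect used (phiv' v) (phiv' w).
    rewrite -cv -lw; apply: (connect_along_path used pc) => u1 u2 uG uq.
    rewrite /used uG; apply/existsP; exists [set a; z].
    by rewrite azE gaz q0.
  by case: az => -[-> ->] //; rewrite used_sym.
have [[|a s] // pq] := cE x y; have sepE f fE := on_path_below r' treeE' (f := f) pq fE.
have pg f : f \in E' -> on_path (a :: s) f -> g f.
  by move=> fE; rewrite sepE //; apply: sepg.
have /and4P[/eqP ax /eqP ly pa _] := pq.
have con : connect used (phiv' x) (phiv' y).
  rewrite -ax -ly; elim: s a pa pg {pq sepE ax ly} => [|z s IH] a //= /andP[azE pz] pg.
  apply: (connect_trans (y := phiv' z)); first by apply: step => //; apply: pg; rewrite ?eqxx.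
  by apply: IH => // f fE fz; apply: pg => //; apply/orP; right.
have [s' [sp _ us]] := connect_spath (fun u v (h : used u v) => proj1 (andP h)) con.
exists (phiv' x :: s'); split=> // e /us[u [v [-> /andP[_ /existsP[f /and3P[]]]]]].
by exists f.
Qed.

End TargetTree.

Lemma hubbing_transfer {T' : finType} {E' : {set {set T'}}} (iota' : V -> T')
    {G : {set {set V}}} {phiv' phie'} {u' : {set V} -> R} :
  is_tree E' -> hubbing W G (UTb W E iota b) E' iota' phiv' phie' u' ->
  exists phiv phie, hubbing W G (UTb W E iota b) E iota phiv phie u'.
Proof.
move=> treeE' [emb u0 [beta' [betaP' leu]]].
case: (treeE') => /card_gt0P[r' _] _ _ _; case: (treeE) => /card_gt0P[r _] sE _ _.
pose cutM f := M (@shore T' E' iota' r' f).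
have [psi psiP] := choice (vertex_of_mincuts iota' r' treeE').
(* The minimum cuts split the terminals exactly as the shores do, so both vertices lie below the
   same edges. *)
have psi_iota i : i \in W -> psi (iota i) = iota' i.
  move=> iW; apply: (below_inj r' treeE') => f fE; rewrite psiP //.
  by have [/cutsP-> // _ _] := MP (@shore T' E' iota' r' f); rewrite inE iW.
pose route h q := (exists v w, h = [set v; w] /\
    spath G (phiv' (psi v)) (phiv' (psi w)) q) /\
  forall e, on_path q e ->
    exists f, [/\ f \in E', crosses h (cutM f) & on_path (phie' f) e].
have [|phie phieP] := @choice _ _ (fun h q => h \in E -> route h q).
  move=> h.
  have [hE|_] := boolP (h \in E); last by exists [::].
  have [v [w [_ eh]]] := simple_edgeP sE hE.
  have [|q [sq qP]] := edge_route iota' r' treeE' (fun f => crosses h (cutM f))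
    (psi v) (psi w) emb.
    by move=> f fE; rewrite !psiP // eh crosses2.
  by exists q => _; split=> //; exists v, w.
exists (phiv' \o psi), phie; split=> //.
  split=> [i iW|h hE]; last by case: (phieP h hE).
  by rewrite /= psi_iota //; case: emb => ->.
have betaP := is_beta_mincut iota r treeE.
have betaM := is_beta_mincut iota' r' treeE'.
exists (fun h => cutcap E b (M (@shore T E iota r h))); split=> // e eG.
apply: le_trans (leu e eG).
(* Double counting of pairs of a tree edge [h] and an [f] with [h] crossing [cutM f]: every [h]
   routed through [e] has such an [f] through [e], and its maximum load is at most [b h]. *)
apply: (@le_trans _ _ (\sum_(f in E' | on_path (phie' f) e) cutcap E b (cutM f))).
  under [leRHS]eq_bigr do rewrite /cutcap.
  rewrite [leRHS]exchange_big /= big_mkcondr; apply: ler_sum => h hE; case: ifP => he.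
    have [_ /(_ e he)[f [fE hf fe]]] := phieP h hE.
    have [[D [[_ Db] <-]] _] := betaP h hE; apply: le_trans (Db h hE) _.
    rewrite (bigD1 f) ?fE //= hf mulr1 lerDl sumr_ge0 // => f' _.
    by rewrite mulr_ge0 ?ler0n ?b0.
  by apply: sumr_ge0 => f _; rewrite mulr_ge0 ?ler0n ?b0.
apply: ler_sum => f /andP[fE _].
have [_ le'] := betaP' f fE; have [[D [UD <-]] _] := betaM f fE; exact: le'.
Qed.

End CapacitatedTree.
End Terminals.

(** * Attainment of the optimum *)

Theorem theorem2 (R : realType) (V : finType) (E : {set {set V}})
    (c : {set V} -> R) (W : {set V})
    (VT : finType) (ET : {set {set VT}}) (iota : V -> VT) (b : {set VT} -> R) :
  simple_edges E ->
  (forall e, e \in E -> 0 <= c e) ->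
  hub_tree W ET iota ->
  (forall f, f \in ET -> 0 <= b f) ->
  (* some hierarchical hubbing for U(T^b) into G exists *)
  (exists (VT' : finType) (ET' : {set {set VT'}}) (iota' : V -> VT')
          (phiv' : VT' -> V) (phie' : {set VT'} -> seq V) (u' : {set V} -> R),
      hub_tree W ET' iota' /\
      hubbing W E (UTb W ET iota b) ET' iota' phiv' phie' u') ->
  exists (phiv : VT -> V) (phie : {set VT} -> seq V) (u : {set V} -> R),
    hubbing W E (UTb W ET iota b) ET iota phiv phie u /\
    forall (VT' : finType) (ET' : {set {set VT'}}) (iota' : V -> VT')
           (phiv' : VT' -> V) (phie' : {set VT'} -> seq V) (u' : {set V} -> R),
      hub_tree W ET' iota' ->
      hubbing W E (UTb W ET iota b) ET' iota' phiv' phie' u' ->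
      cost E c u <= cost E c u'.
Proof.
move=> _ c0 [treeT iota_inj _] b0 [VT0 [ET0 [iota0 [phiv0 [phie0 [u0 [[tree0 _ _] hub0]]]]]]].
have [M MP] := choice (smallest_mincut_exists (E := ET) W iota b iota_inj).
have transfer := hubbing_transfer W iota b treeT iota_inj b0 MP.
have [phiv1 [phie1 [emb1 u0_ge0 [beta [betaP le_u0]]]]] := transfer _ _ _ _ _ _ _ tree0 hub0.
have beta_unique beta' : is_beta W (UTb W ET iota b) ET iota beta' ->
    forall f, f \in ET -> beta f = beta' f.
  move=> betaP' f fE; have [[D [UD eD]] le] := betaP f fE.
  have [[D' [UD' eD']] le'] := betaP' f fE; apply: le_anti.
  by apply/andP; split; [rewrite -eD; exact: le' | rewrite -eD'; exact: le].
have beta0 f : f \in ET -> 0 <= beta f.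
  move=> fE; have [_ le] := betaP f fE.
  have load0 g : load W ET iota (fun=> 0) g = 0 :> R.
    by apply: big1 => p _; case: ifP.
  (* The zero demand lies in the universe, so maximum loads are nonnegative. *)
  by rewrite -(load0 f); apply: le; split=> // g gE; rewrite load0 b0.
(* The cost of an embedding depends only on its edge sets, of which there are
   finitely many. *)
pose K := {ffun {set VT} -> {set {set V}}}.
pose traces (phie : {set VT} -> seq V) : K := [ffun f => [set e in E | on_path (phie f) e]].
pose feasible (k : K) :=
  `[< exists phiv phie, embedding W E ET iota phiv phie /\ k = traces phie >].
pose price (k : K) := cost E c (fun e => \sum_(f in ET | e \in k f) beta f).
have feas1 : feasible (traces phie1) by apply/asboolP; exists phiv1, phie1.
case: (@arg_minP _ R _ _ feasible price feas1) => k /asboolP[phiv [phie [emb ek]]] kmin.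
pose use (phie : {set VT} -> seq V) e := \sum_(f in ET | on_path (phie f) e) beta f.
have priceE phie' : price (traces phie') = cost E c (use phie').
  apply: eq_bigr => e eE; congr (_ * _); apply: eq_bigl => f.
  by rewrite ffunE inE eE.
exists phiv, phie, (use phie); split.
  split=> // [e _|]; first by apply: sumr_ge0 => f /andP[/beta0].
  by exists beta.
move=> VT' ET' iota' phiv' phie' u' [tree' _ _] hub'.
have [phiv2 [phie2 [emb2 _ [beta2 [beta2P le_u']]]]] := transfer _ _ _ _ _ _ _ tree' hub'.
(* A competitor's [u'] also serves some embedding of the given tree, and pointwise it is at least
   what that embedding uses. *)
rewrite -priceE -ek; apply: (le_trans (kmin (traces phie2) _)).
  by apply/asboolP; exists phiv2, phie2.
rewrite priceE; apply: ler_sum => e eE; rewrite ler_wpM2l ?c0 //.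
apply: le_trans (le_u' e eE); rewrite le_eqVlt; apply/orP; left; apply/eqP.
by apply: eq_bigr => f /andP[fE _]; apply: beta_unique.
Qed.
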